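(* Let $U$ be a regular Greenian domain with base point $x_0$ and a countable compact exhaustion $C_0\Subset C_1\Subset\cdots$ with $x_0\in C_0$, and let $\theta_n(h;x)=h(x)/c_n$ for $h\in H_1^+(U,x_0)$, $x\in C_n$, be the normalized evaluation predicates in the language $\mathcal L_{\mathrm{Har}}(U,x_0)$ described in the context. For every $n$, the $\mathcal L_{\mathrm{Har}}(U,x_0)$-formula $\theta_n(h;x)$ is stable.
   Context: $(X,\tau)$ is a nonempty, locally compact, locally connected Hausdorff space with a sheaf $H$ of continuous real functions (harmonic functions, $H(U)$ a linear space) forming a Brelot harmonic space: there is a base $\tau_0$ of relatively compact regular open sets (regular: every $g\in C(\partial U)$ has a unique harmonic extension with boundary values $g$, nonnegative if $g\ge0$), and increasing sequences of harmonic functions on a connected $U\in\tau_0$ have supremum harmonic or $\equiv+\infty$; equivalently, Harnack inequalities hold. $\mathcal L_{\mathrm{Har}}$ is the many-sorted continuous language with a metric point sort $X$ and, for $U\in\tau_0$, metric sorts for $U$, for $H(U)$ and for boundary functions, with symbols for inclusions, restrictions, the Dirichlet operator and the evaluation $\operatorname{Eval}_U(x,h)=h(x)$. Fix a regular Greenian domain $U\in\tau_0$ (one possessing a Green kernel), $x_0\in U$, a dense $A\subseteq U$, and $Ax_0=A\cup\{x_0\}$. $H_1^+(U,x_0)$ is the set of nonnegative harmonic $h$ on $U$ with $h(x_0)=1$. Assume that $U$ has a countable compact exhaustion $C_0\Subset C_1\Subset\cdots$ with $x_0\in C_0$, $\bigcup_nC_n=U$. For each $n$, $c_n\ge1$ is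 a Harnack constant: $h(x)\le c_nh(x_0)$ for all $x\in C_n$ and all positive harmonic $h$ on $U$. So $\theta_n(h;x)=h(x)/c_n$ satisfies $0\le\theta_n\le1$. $\mathcal L_{\mathrm{Har}}(U,x_0)$ is a fixed predicate expansion of the $Ax_0$-definitional expansion which names the compact loci $C_n$ as metric sorts and names each bounded uniformly continuous predicate $\theta_n$ on $H_1^+(U,x_0)\times C_n$. The theory is the complete theory of the resulting local structure. A bounded formula $\delta(u;v)$ is stable if it has no order property: there are no $\varepsilon>0$, $r\in\mathbb R$, and sequences $(a_i)_{i<\omega}$, $(b_i)_{i<\omega}$ such that whenever $i<j<\omega$ one has $\delta(a_i;b_j)\le r$ and $\delta(a_j;b_i)\ge r+\varepsilon$. (Equivalently: the double-limit criterion holds, i.e. whenever both iterated limits of $\delta(a_i;b_j)$ exist they are equal; or, the family of instances is relatively weakly compact in $C(S_v(M))$, where $S_v(M)$ is the space of types in $v$ over a model $M$.) *)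

(* Defs.v *)
From mathcomp Require Import all_boot all_order all_algebra.
From mathcomp Require Import all_classical all_reals all_analysis.
Set Implicit Arguments.
Unset Strict Implicit.
Unset Printing Implicit Defensive.
Import Order.TTheory GRing.Theory Num.Theory.
Import numFieldNormedType.Exports.
Local Open Scope classical_set_scope.
Local Open Scope ring_scope.

(** * Many-sorted continuous logic *)

(* Contexts are lists of sorts and variables are typed de Bruijn indices, so
   that sorts are allowed to be empty. *)
Fixpoint env (S : Type) (T : S -> Type) (G : seq S) : Type :=
  if G is s :: G' then (T s * env T G')%type else unit.

Fixpoint env_cat (S : Type) (T : S -> Type) (G D : seq S) :
    env T G -> env T D -> env T (G ++ D) :=
  match G with
  | [::] => fun _ v => v
  | _ :: _ => fun u v => (u.1, env_cat u.2 v)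
  end.

Inductive var (S : Type) : seq S -> S -> Type :=
| VZ : forall s G, var (s :: G) s
| VS : forall s t G, var G s -> var (t :: G) s.

Fixpoint lookup (S : Type) (T : S -> Type) (G : seq S) (s : S)
    (v : var G s) : env T G -> T s :=
  match v in var G s return env T G -> T s with
  | VZ _ _ => fun e => e.1
  | VS _ _ _ w => fun e => lookup w e.2
  end.

(* No moduli of uniform continuity are attached to the symbols: that a symbol
   obeys a given modulus is expressed by sentences, hence passes from a
   structure to all the models of its theory. *)
Record signature : Type := Signature {
  sort : Type;
  fsym : Type;
  fdom : fsym -> seq sort;
  fcod : fsym -> sort;
  psym : Type;
  pdom : psym -> seq sort }.

Record is_metric (R : realType) (T : Type) (d : T -> T -> R) : Prop := IsMetric {
  metric_eq0 : forall x y, d x y = 0 <-> x = y;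
  metric_symmetric : forall x y, d x y = d y x;
  metric_trans : forall x y z, d x z <= d x y + d y z }.

(* Sorts need not be complete: the points of a domain are a metric sort. *)
Record structure (R : realType) (L : signature) : Type := Structure {
  carrier :> sort L -> Type;
  sdist : forall s, carrier s -> carrier s -> R;
  sdistP : forall s, is_metric (@sdist s);
  fint : forall f : fsym L, env carrier (fdom f) -> carrier (fcod f);
  pint : forall p : psym L, env carrier (pdom p) -> R }.

Inductive term (L : signature) (G : seq (sort L)) : sort L -> Type :=
| Var : forall s, var G s -> term G s
| App : forall f : fsym L, terms G (fdom f) -> term G (fcod f)
with terms (L : signature) (G : seq (sort L)) : seq (sort L) -> Type :=
| TNil : terms G [::]
| TCons : forall s D, term G s -> terms G D -> terms G (s :: D).

Fixpoint eval_term (R : realType) (L : signature) (M : structure R L)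
    (G : seq (sort L)) (e : env M G) (s : sort L) (t : term G s) : M s :=
  match t in term _ s return M s with
  | Var _ v => lookup v e
  | App f ts => @fint R L M f (eval_terms e ts)
  end
with eval_terms (R : realType) (L : signature) (M : structure R L)
    (G : seq (sort L)) (e : env M G) (D : seq (sort L)) (ts : terms G D) :
    env M D :=
  match ts in terms _ D return env M D with
  | TNil => tt
  | TCons _ _ t ts' => (eval_term e t, eval_terms e ts')
  end.

(* Predicates and distances may be unbounded, so a quantifier carries an
   interval [a, b] to which the quantified formula is truncated; this is
   ordinary quantification for a formula with values in [a, b].  Over an empty
   sort both quantifiers have value 0. *)
Inductive formula (R : realType) (L : signature) : seq (sort L) -> Type :=
| FPred : forall G (p : psym L), terms G (pdom p) -> formula R G
| FDist : forall G s, term G s -> term G s -> formula R G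
| FConn : forall G (k : nat) (u : 'rV[R]_k -> R),
    continuous u -> ('I_k -> formula R G) -> formula R G
| FSup : forall G (a b : R) s, formula R (s :: G) -> formula R G
| FInf : forall G (a b : R) s, formula R (s :: G) -> formula R G.

Definition clamp (R : realType) (a b y : R) : R := Num.max a (Num.min b y).

Fixpoint eval_formula (R : realType) (L : signature) (M : structure R L)
    (G : seq (sort L)) (phi : formula R G) : env M G -> R :=
  match phi in formula _ G return env M G -> R with
  | FPred _ p ts => fun e => @pint R L M p (eval_terms e ts)
  | FDist _ _ t1 t2 => fun e => sdist (eval_term e t1) (eval_term e t2)
  | FConn _ _ u _ phis => fun e => u (\row_i eval_formula (phis i) e)
  | FSup _ a b s psi => fun e =>
      sup (range (fun x : M s => clamp a b (@eval_formula R L M _ psi (x, e))))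
  | FInf _ a b s psi => fun e =>
      inf (range (fun x : M s => clamp a b (@eval_formula R L M _ psi (x, e))))
  end.

Definition sentence (R : realType) (L : signature) : Type :=
  formula R ([::] : seq (sort L)).

Definition theory (R : realType) (L : signature) (M : structure R L) :
    set (sentence R L) := [set phi | @eval_formula R L M [::] phi tt = 0].

Definition models (R : realType) (L : signature) (N : structure R L)
    (T : set (sentence R L)) : Prop := T `<=` theory N.

Definition order_property (R : realType) (L : signature) (N : structure R L)
    (G D : seq (sort L)) (delta : formula R (G ++ D)) : Prop :=
  exists (eps r : R) (a : nat -> env N G) (b : nat -> env N D),
    0 < eps /\
    forall i j : nat, (i < j)%N ->
      eval_formula delta (env_cat (a i) (b j)) <= r /\
      r + eps <= eval_formula delta (env_cat (a j) (b i)).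

Definition stable (R : realType) (L : signature) (T : set (sentence R L))
    (G D : seq (sort L)) (delta : formula R (G ++ D)) : Prop :=
  forall N : structure R L, models N T -> ~ @order_property R L N G D delta.

(** * Brelot harmonic spaces *)

Definition locally_connected_space (X : topologicalType) : Prop :=
  forall (x : X) (O : set X), nbhs x O ->
    exists V : set X, [/\ open V, connected V, V x & V `<=` O].

(* Used for open V only. *)
Definition bdry (X : topologicalType) (V : set X) : set X := closure V `\` V.

Lemma bdry_closure (X : topologicalType) (V : set X) : bdry V `<=` closure V.
Proof. by move=> x []. Qed.

Section Harmonic.
Context (R : realType) (X : topologicalType).
Context (H : forall V : set X, set (V -> R)).

Definition dirichlet_solution (V : set X) (g : bdry V -> R) (h : V -> R) :
    Prop :=
  H h /\ exists F : closure V -> R,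
    [/\ continuous F,
        forall x : V, F (subfun (@subset_closure X V) x) = h x
      & forall y : bdry V, F (subfun (@bdry_closure X V) y) = g y].

Definition regular_set (V : set X) : Prop :=
  open V /\
  forall g : bdry V -> R, continuous g ->
    exists h : V -> R,
      [/\ dirichlet_solution g h,
          forall h', dirichlet_solution g h' -> h' = h
        & (forall y, 0 <= g y) -> forall x, 0 <= h x].

Record brelot (tau0 : set (set X)) : Prop := Brelot {
  brelot_nonempty : [set: X] !=set0;
  brelot_locally_compact : locally_compact [set: X];
  brelot_locally_connected : locally_connected_space X;
  brelot_hausdorff : hausdorff_space X;
  har_continuous : forall (V : set X) (h : V -> R), open V -> H h -> continuous h;
  har_zero : forall V : set X, open V -> H (fun _ : V => 0);
  har_linear : forall (V : set X) (a : R) (h k : V -> R), open V -> H h -> H k ->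
    H (fun x => a * h x + k x);
  har_restrict : forall (V W : set X) (VW : V `<=` W) (h : W -> R),
    open V -> open W -> H h -> H (h \o subfun VW);
  har_glue : forall (V : set X) (h : V -> R), open V ->
    (forall x : V, exists (W : set X) (WV : W `<=` V),
      [/\ open W, W (val x) & H (h \o subfun WV)]) -> H h;
  base_regular : forall V, tau0 V -> regular_set V;
  base_relatively_compact : forall V, tau0 V -> compact (closure V);
  base_basis : basis tau0;
  (* If the connected members of tau0 form a base, the case of connected V in
     tau0 implies that of all domains V. *)
  har_convergence : forall (V : set X) (h : nat -> V -> R), open V -> connected V ->
    (forall n, H (h n)) -> (forall n x, h n x <= h n.+1 x) ->
    (exists2 k : V -> R, H k &
      forall x, ereal_sup (range (fun n => (h n x)%:E)) = (k x)%:E) \/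
    (forall x, ereal_sup (range (fun n => (h n x)%:E)) = +oo%E) }.

Definition superharmonic (tau0 : set (set X)) (U : set X) (s : U -> \bar R) :
    Prop :=
  [/\ lower_semicontinuous s,
      forall x, s x != -oo%E,
      exists x, s x != +oo%E
    & forall (V : set X) (VU : closure V `<=` U) (g : bdry V -> R) (h : V -> R),
        tau0 V -> continuous g -> dirichlet_solution g h ->
        (forall y, ((g y)%:E <= s (subfun VU (subfun (@bdry_closure X V) y)))%E) ->
        forall x, ((h x)%:E <= s (subfun VU (subfun (@subset_closure X V) x)))%E].

Definition potential (tau0 : set (set X)) (U : set X) (p : U -> \bar R) : Prop :=
  [/\ superharmonic tau0 p,
      forall x, (0 <= p x)%E
    & forall h : U -> R, H h -> (forall x, ((h x)%:E <= p x)%E) ->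
        forall x, h x <= 0].

(* The pole is the second variable. *)
Definition green_kernel (tau0 : set (set X)) (U : set X)
    (G : U -> U -> \bar R) : Prop :=
  [/\ forall x y, (0 < G x y)%E,
      lower_semicontinuous (fun z : U * U => G z.1 z.2),
      forall z : U * U, z.1 <> z.2 ->
        {for z, continuous (fun z : U * U => G z.1 z.2)},
      forall y, potential tau0 (G^~ y)
    & forall y : U, exists2 h : (U `\ val y) -> R, H h &
        forall x : U `\ val y, G (subfun (@subDsetl X U [set val y]) x) y =
                               (h x)%:E].

Definition greenian (tau0 : set (set X)) (U : set X) : Prop :=
  exists G : U -> U -> \bar R, green_kernel tau0 G.

Definition H1pos (U : set X) (x0 : U) : set (U -> R) :=
  [set h | [/\ H h, forall x, 0 <= h x & h x0 = 1]].

Record local_setting (tau0 : set (set X)) (U : tau0) (x0 : val U)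
    (A : set (val U)) (C : nat -> set (val U)) (c : nat -> R) : Prop :=
  LocalSetting {
    local_connected : connected (val U);
    local_greenian : greenian tau0 (val U);
    local_dense : dense A;
    exh_compact : forall n, compact (C n);
    exh_interior : forall n, C n `<=` (C n.+1)°;
    exh_base : C 0%N x0;
    exh_cover : \bigcup_n C n = [set: val U];
    harnack_ge1 : forall n, 1 <= c n;
    harnack : forall n (h : val U -> R), H h -> (forall x, 0 < h x) ->
      forall x, C n x -> h x <= c n * h x0 }.

End Harmonic.

(** * The language and the local structure *)

Section Language.
Context (R : realType) (X : topologicalType).
Context (H : forall V : set X, set (V -> R)) (tau0 : set (set X)).

Inductive har_sort : Type :=
| SPoint                    (* X *)
| SDom of tau0              (* V *)
| SHar of tau0              (* H(V) *)
| SBdry of tau0             (* C(bdry V) *)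
| SPos                      (* H_1^+(U, x0) *)
| SExh of nat.              (* C n *)

Context (U : tau0) (x0 : val U) (A : set (val U)).

Inductive har_fsym : Type :=
| FIncPoint of tau0
| FInc : forall V W : tau0, val V `<=` val W -> har_fsym
| FRes : forall V W : tau0, val V `<=` val W -> har_fsym
| FDir of tau0
| FCst of A `|` [set x0]
| FIncPos
| FIncExh of nat.

Definition har_fdom (f : har_fsym) : seq har_sort :=
  match f with
  | FIncPoint V => [:: SDom V]
  | FInc V W _ => [:: SDom V]
  | FRes V W _ => [:: SHar W]
  | FDir V => [:: SBdry V]
  | FCst _ => [::]
  | FIncPos => [:: SPos]
  | FIncExh n => [:: SExh n]
  end.

Definition har_fcod (f : har_fsym) : har_sort :=
  match f with
  | FIncPoint V => SPoint
  | FInc V W _ => SDom W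
  | FRes V W _ => SHar V
  | FDir V => SHar V
  | FCst _ => SDom U
  | FIncPos => SHar U
  | FIncExh _ => SDom U
  end.

(* The extra predicate symbols PExt e, of arbitrary arities, account for the
   definitional expansion and for the predicate expansion. *)
Context (E : Type) (arity : E -> seq har_sort).

Inductive har_psym : Type :=
| PEval of tau0
| PTheta of nat
| PExt of E.

Definition har_pdom (p : har_psym) : seq har_sort :=
  match p with
  | PEval V => [:: SDom V; SHar V]
  | PTheta n => [:: SPos; SExh n]
  | PExt e => arity e
  end.

Definition LHar : signature := Signature har_fdom har_fcod har_pdom.

Context (C : nat -> set (val U)) (c : nat -> R).

Definition har_carrier (s : har_sort) : Type :=
  match s with
  | SPoint => X
  | SDom V => val V
  | SHar V => {h : val V -> R | H h}
  | SBdry V => {g : bdry (val V) -> R | continuous g}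
  | SPos => {h : val U -> R | H1pos H x0 h}
  | SExh n => C n
  end.

Context (B : brelot H tau0).

Lemma base_open (V : tau0) : open (val V).
Proof. by case: (base_regular B (set_valP V)). Qed.

Definition har_res (V W : tau0) (VW : val V `<=` val W)
    (h : har_carrier (SHar W)) : har_carrier (SHar V) :=
  exist _ (sval h \o subfun VW)
    (har_restrict B VW (base_open V) (base_open W) (svalP h)).

Lemma dirichlet_exists (V : tau0) (g : har_carrier (SBdry V)) :
  exists h : val V -> R, dirichlet_solution H (sval g) h.
Proof.
by case: (base_regular B (set_valP V)) => _ /(_ _ (svalP g)) [h []]; exists h.
Qed.

Definition har_dir (V : tau0) (g : har_carrier (SBdry V)) :
    har_carrier (SHar V) :=
  let h := cid (dirichlet_exists g) in exist _ (sval h) (svalP h).1.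

Definition har_incpos (h : har_carrier SPos) : har_carrier (SHar U) :=
  exist _ (sval h) (let: And3 Hh _ _ := svalP h in Hh).

Definition har_fint (f : har_fsym) :
    env har_carrier (har_fdom f) -> har_carrier (har_fcod f) :=
  match f with
  | FIncPoint V => fun e => val e.1
  | FInc V W VW => fun e => subfun VW e.1
  | FRes V W VW => fun e => har_res VW e.1
  | FDir V => fun e => har_dir e.1
  | FCst a => fun _ => val a
  | FIncPos => fun e => har_incpos e.1
  | FIncExh n => fun e => val e.1
  end.

Definition theta (n : nat) (h : har_carrier SPos) (x : har_carrier (SExh n)) :
    R := sval h (val x) / c n.

Context (ext : forall e : E, env har_carrier (arity e) -> R).

Definition har_pint (p : har_psym) : env har_carrier (har_pdom p) -> R :=
  match p with
  | PEval V => fun e => sval e.2.1 e.1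
  | PTheta n => fun e => theta e.1 e.2.1
  | PExt e => @ext e
  end.

Context (d : forall s, har_carrier s -> har_carrier s -> R).

Definition theta_uniformly_continuous (n : nat) : Prop :=
  forall eps : R, 0 < eps -> exists2 eta : R, 0 < eta &
    forall (h h' : har_carrier SPos) (x x' : har_carrier (SExh n)),
      d h h' < eta -> d x x' < eta -> `|theta h x - theta h' x'| < eps.

Context (dP : forall s, is_metric (@d s)).

Definition local_structure : structure R LHar :=
  @Structure R LHar har_carrier d dP har_fint har_pint.

Definition theta_formula (n : nat) :
    formula R (([:: SPos] : seq (sort LHar)) ++ [:: SExh n]) :=
  @FPred R LHar [:: SPos; SExh n] (PTheta n)
    (TCons (Var (VZ _ _)) (TCons (Var (VS _ (VZ _ _))) (TNil _))).

End Language.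

(* Main.v *)
Require Import Defs.
From mathcomp Require Import all_boot all_order all_algebra.
From mathcomp Require Import all_classical all_reals all_analysis.
From mathcomp Require Import ring lra.
Set Implicit Arguments.
Unset Strict Implicit.
Unset Printing Implicit Defensive.
Import Order.TTheory GRing.Theory Num.Theory.
Import numFieldNormedType.Exports.
Local Open Scope classical_set_scope.
Local Open Scope ring_scope.

(** Over the compact set C n, the functions theta(h; .) with h in H_1^+(U, x0)
    form a totally bounded family for the supremum norm, and this prevents the
    order property uniformly.  Indeed, if a_i and b_j witness the order
    property with gap eps, then b_(2i+1) separates a_(2i) from a_(2j) whenever
    i < j, so that the instances theta(a_(2i); .) lie at mutual distance at
    least eps; a totally bounded family has no such tuple of length k for some
    k.  The absence of a separated tuple of length k is the vanishing of a
    sentence of quantifier depth k + 1, hence it passes from the local structure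
    to every model of its theory
    ([no_separated_tuple_elementary], [stable_of_no_separated_tuple]).

    Total boundedness ([totally_bounded_on_compact]) is the Montel property of
    a Brelot space.  Monotone convergence gives Harnack's inequality
    ([harnack_inequality]): a sum of badly behaved positive harmonic functions
    would converge at one point and be unbounded on a compact set.  Let D_V g
    be the harmonic function on a regular V with boundary values g.  The
    Cauchy-Schwarz inequality for the positive functional g |-> D_V g x and
    Harnack's inequality for D_V (g^2) give, for x in a compact neighbourhood
    of a point p of V,
      (D_V g x)^2 <= c * D_V (g^2) p       ([poisson_sqr_le]).
    Thus point evaluations are uniformly bounded in the L^2 norm of the
    harmonic measure at p.  Take regular neighbourhoods V1 and V2 of p, with
    the closure of V1 in V2 and that of V2 in U, and the semi-inner products
    B_i(f, g) = D_Vi (f g) p on the harmonic functions on U.  Bounded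
    evaluations make the comparison of B_1 with B_2 of trace class: for e_1,
    ..., e_n orthonormal for B_2, the function u = sum_k e_k(x) e_k satisfies
    u(x) = B_2(u, u) = sum_k e_k(x)^2, whence sum_k e_k(x)^2 <= c for x in the
    boundary of V1 and sum_k B_1(e_k, e_k) <= c * D_V1 1 p.  Such a trace bound
    makes B_2-balls totally bounded for B_1 ([trace_totally_bounded]), as for a
    Hilbert-Schmidt operator.  By Harnack's inequality H_1^+(U, x0) lies in a
    B_2-ball, and by [poisson_sqr_le] for V1 the seminorm of B_1 dominates the
    supremum norm near p.  Compactness of C n concludes. *)

(** * Semi-inner products and total boundedness *)

(** Finite colourings rather than finite nets: they restrict to subfamilies
    and combine by products, and a tuple with pairwise far members has
    pairwise distinct colours. *)
Definition totally_bounded_for (T : Type) (F : set T) (close : T -> T -> Prop) :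
    Prop :=
  exists (C : finType) (color : T -> C),
    forall f g, F f -> F g -> color f = color g -> close f g.

Lemma totally_bounded_forI (T : Type) (F : set T) (r1 r2 : T -> T -> Prop) :
  totally_bounded_for F r1 -> totally_bounded_for F r2 ->
  totally_bounded_for F (fun f g => r1 f g /\ r2 f g).
Proof.
move=> [C1 [c1 H1]] [C2 [c2 H2]]; exists (C1 * C2)%type, (fun f => (c1 f, c2 f)).
by move=> f g Ff Fg [e1 e2]; split; [exact: H1 | exact: H2].
Qed.

Lemma totally_bounded_for_le (T : Type) (F G : set T) (r1 r2 : T -> T -> Prop) :
  F `<=` G -> (forall f g, F f -> F g -> r1 f g -> r2 f g) ->
  totally_bounded_for G r1 -> totally_bounded_for F r2.
Proof.
move=> FG r12 [C [c HC]]; exists C, c => f g Ff Fg e.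
by apply: r12 => //; apply: HC => //; exact: FG.
Qed.

(** The colour of a vector is the tuple of cells, in a subdivision of [-a, a]
    of mesh eta, that contain its n bounded coordinates. *)
Lemma totally_bounded_for_coord (R : realType) (E : Type) (n : nat)
    (t : 'I_n -> E -> R) (a eta : R) :
  0 < eta ->
  totally_bounded_for [set u | forall k, `|t k u| <= a]
    (fun u v => forall k, `|t k u - t k v| <= eta).
Proof.
move=> eta0; pose N := Num.truncn (2 * a / eta).
pose cell (x : R) : 'I_N.+1 := inord (Num.truncn ((x + a) / eta)).
exists {ffun 'I_n -> 'I_N.+1}, (fun u => [ffun k => cell (t k u)]).
move=> u v /= bu bv /ffunP euv k; move/(_ k): euv; rewrite !ffunE /cell.
have cellE x : `|x| <= a ->
    (Num.truncn ((x + a) / eta) < N.+1)%N /\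
    (Num.truncn ((x + a) / eta))%:R * eta <= x + a <
      (Num.truncn ((x + a) / eta)).+1%:R * eta.
  rewrite ler_norml => /andP[lx ux].
  have xa0 : 0 <= x + a by lra.
  have := truncn_itv (divr_ge0 xa0 (ltW eta0)).
  rewrite ler_pdivlMr// ltr_pdivrMr// => ->; split=> //.
  by rewrite ltnS; apply: le_truncn; rewrite ler_pM2r ?invr_gt0//; lra.
have [lu /andP[u1 u2]] := cellE _ (bu k); have [lv /andP[v1 v2]] := cellE _ (bv k).
move=> /(congr1 val); rewrite /= !inordK// => euv.
move: u1 u2 v1 v2; rewrite -euv -natr1; set m := _%:R => u1 u2 v1 v2.
by rewrite ler_norml; apply/andP; split; lra.
Qed.

Section HilbertSchmidt.
Context (R : realType) (E : lmodType R) (S : set E).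

(** Bilinearity is required on S only: the forms to come are integrals of
    products, which make sense for functions with enough continuity. *)
Record semi_inner (B : E -> E -> R) : Prop := SemiInner {
  semi_inner_linear : forall a u v w, S u -> S v -> S w ->
    B (a *: u + v) w = a * B u w + B v w;
  semi_inner_sym : forall u v, B u v = B v u;
  semi_inner_ge0 : forall u, S u -> 0 <= B u u }.

Context (S0 : S 0) (Slin : forall a u v, S u -> S v -> S (a *: u + v)).

Lemma sub_sum n (t : 'I_n -> R) (e : 'I_n -> E) :
  (forall k, S (e k)) -> S (\sum_k t k *: e k).
Proof.
move=> Se; elim: n t e Se => [|n IH] t e Se; first by rewrite big_ord0.
by rewrite big_ord_recl; apply: Slin => //; exact: IH.
Qed.

Lemma semi_inner_suml (B : E -> E -> R) n (t : 'I_n -> R) (e : 'I_n -> E) v :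
  semi_inner B -> (forall k, S (e k)) -> S v ->
  B (\sum_k t k *: e k) v = \sum_k t k * B (e k) v.
Proof.
move=> [Bl _ _] Se Sv; elim: n t e Se => [|n IH] t e Se.
  rewrite !big_ord0; have := Bl 1 0 0 v S0 S0 Sv.
  by rewrite scaler0 addr0 mul1r => /eqP; rewrite -subr_eq0 opprD addNKr oppr_eq0 => /eqP.
by rewrite !big_ord_recl Bl ?IH//; exact: sub_sum.
Qed.

Lemma semi_inner_sqrD (B : E -> E -> R) a u v : semi_inner B -> S u -> S v ->
  B (a *: u + v) (a *: u + v) = a ^+ 2 * B u u + 2 * a * B u v + B v v.
Proof.
move=> [Bl Bs _] Su Sv; rewrite Bl//; last exact: Slin.
rewrite (Bs u) (Bs v) !Bl// (Bs v u); ring.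
Qed.

Lemma semi_inner_parallelogram (B : E -> E -> R) u v : semi_inner B ->
  S u -> S v -> B (u + v) (u + v) <= 2 * B u u + 2 * B v v.
Proof.
move=> BP Su Sv.
have := semi_inner_ge0 BP (Slin (-1) Su Sv).
have := semi_inner_sqrD 1 BP Su Sv; rewrite scale1r => ->.
by rewrite (semi_inner_sqrD (-1) BP)//; lra.
Qed.

(** The usual argument: minimize B (a u + v) (a u + v) >= 0 over a. *)
Lemma semi_inner_Cauchy_Schwarz (B : E -> E -> R) u v : semi_inner B -> S u -> S v ->
  B u v ^+ 2 <= B u u * B v v.
Proof.
move=> BP Su Sv.
have sqr_ge a : 0 <= a ^+ 2 * B u u + 2 * a * B u v + B v v.
  by rewrite -semi_inner_sqrD//; apply: (semi_inner_ge0 BP); exact: Slin.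
have [uu0|uu0] := eqVneq (B u u) 0.
  have [->|uv0] := eqVneq (B u v) 0; first by rewrite expr0n uu0 mul0r.
  have := sqr_ge (- (B v v + 1) / (2 * B u v)); rewrite uu0 mulr0 add0r.
  rewrite (_ : 2 * _ * _ = - (B v v + 1)); first by lra.
  by field.
have uu_gt0 : 0 < B u u by rewrite lt_def uu0 (semi_inner_ge0 BP).
have := sqr_ge (- B u v / B u u).
rewrite (_ : _ + _ = (B u u * B v v - B u v ^+ 2) / B u u); last by field.
by rewrite ler_pdivlMr// mul0r subr_ge0.
Qed.

Context (B1 B2 : E -> E -> R) (B1P : semi_inner B1) (B2P : semi_inner B2) (K : R).

Definition orthonormal n (e : 'I_n -> E) : Prop :=
  (forall k, S (e k)) /\ forall i j, B2 (e i) (e j) = (i == j)%:R.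

Lemma orthonormal_pairing n (e : 'I_n -> E) t j : orthonormal e ->
  B2 (\sum_k t k *: e k) (e j) = t j.
Proof.
move=> [Se ee]; rewrite semi_inner_suml// (bigD1 j)//= ee eqxx mulr1.
by rewrite big1 ?addr0// => i /negbTE ij; rewrite ee ij mulr0.
Qed.

Lemma orthonormal_pythagoras n (e : 'I_n -> E) t : orthonormal e ->
  B2 (\sum_k t k *: e k) (\sum_k t k *: e k) = \sum_k t k ^+ 2.
Proof.
move=> oe; have [Se _] := oe; rewrite semi_inner_suml//; last exact: sub_sum.
apply: eq_bigr => k _.
by rewrite (semi_inner_sym B2P) orthonormal_pairing.
Qed.

Lemma orthonormal_cons n (e : 'I_n -> E) r : orthonormal e -> S r ->
  B2 r r = 1 -> (forall k, B2 r (e k) = 0) ->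
  orthonormal (fun i => oapp e r (unlift ord0 i)).
Proof.
move=> [Se ee] Sr rr re; split=> [k|i j]; first by case: unliftP => [j|] _ /=.
case: (unliftP ord0 i) => [i'|] ->; case: (unliftP ord0 j) => [j'|] -> /=.
- by rewrite ee (inj_eq lift_inj).
- by rewrite (semi_inner_sym B2P) re.
- by rewrite re.
- by rewrite rr.
Qed.

Lemma semi_innerZl (B : E -> E -> R) a u v : semi_inner B -> S u -> S v ->
  B (a *: u) v = a * B u v.
Proof.
move=> BP Su Sv.
have := semi_inner_suml (fun=> a) BP (fun _ : 'I_1 => Su) Sv.
by rewrite !big_ord_recl !big_ord0 !addr0.
Qed.

Context (trace_le : forall n (e : 'I_n -> E),
  orthonormal e -> \sum_k B1 (e k) (e k) <= K).
Context (null : forall u, S u -> B2 u u = 0 -> B1 u u = 0).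

(** Bounds on unit vectors extend to a cone Q by homogeneity, B2-null vectors
    being B1-null. *)
Lemma bound_of_unit_vectors (Q : set E) c :
  (forall a u, S u -> Q u -> Q (a *: u)) ->
  (forall u, S u -> Q u -> B2 u u = 1 -> B1 u u <= c) ->
  forall u, S u -> Q u -> B1 u u <= c * B2 u u.
Proof.
move=> QZ unit_le u Su Qu.
have [B2u0|B2u0] := eqVneq (B2 u u) 0.
  by rewrite (null Su B2u0) B2u0 mulr0.
have B2u_gt0 : 0 < B2 u u by rewrite lt_def B2u0 (semi_inner_ge0 B2P).
pose a := (Num.sqrt (B2 u u))^-1.
have a2 : a ^+ 2 = (B2 u u)^-1 by rewrite exprVn sqr_sqrtr// ltW.
have Sau : S (a *: u) by have := Slin a Su S0; rewrite addr0.
have auE B : semi_inner B -> B (a *: u) (a *: u) = (B2 u u)^-1 * B u u.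
  move=> BP; rewrite semi_innerZl// (semi_inner_sym BP) semi_innerZl// -a2; ring.
have := unit_le (a *: u) Sau (QZ _ _ Su Qu).
by rewrite !auE// mulVf// ler_pdivrMl// mulrC; apply.
Qed.

(** If an orthonormal family has nearly maximal trace, a unit vector orthogonal
    to it can only add eps to the trace; so B1 is small, relatively to B2, on
    the orthogonal complement of that finite family. *)
Lemma orthonormal_exhaust eps : 0 < eps -> exists n (e : 'I_n -> E),
  orthonormal e /\
  forall r, S r -> (forall k, B2 r (e k) = 0) -> B1 r r <= eps * B2 r r.
Proof.
move=> eps0.
pose A := [set v | exists n (e : 'I_n -> E),
  orthonormal e /\ v = \sum_k B1 (e k) (e k)].
have A_sup : has_sup A.
  split; last by exists K => _ [n [e [oe ->]]]; exact: trace_le.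
  by exists 0, 0%N, (fun=> 0); rewrite big_ord0; split=> //; split=> -[].
have [_ [n [e [oe ->]]] e_sup] := sup_adherent eps0 A_sup.
exists n, e; split=> //.
apply: (@bound_of_unit_vectors [set r | forall k, B2 r (e k) = 0]).
  by move=> a r Sr /= re k; rewrite semi_innerZl ?re ?mulr0//; exact: oe.1.
move=> r Sr re rr.
have Ar : A (B1 r r + \sum_k B1 (e k) (e k)).
  exists n.+1, (fun i => oapp e r (unlift ord0 i)); split.
    exact: orthonormal_cons.
  rewrite big_ord_recl unlift_none; congr (_ + _).
  by apply: eq_bigr => i _; rewrite liftK.
have := ub_le_sup A_sup.2 Ar; lra.
Qed.

Lemma trace_bound u : S u -> B1 u u <= K * B2 u u.
Proof.
move=> Su; apply: (@bound_of_unit_vectors setT) => // v Sv _ vv.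
have := @trace_le 1 (fun=> v); rewrite big_ord1; apply; split=> // i j.
by rewrite !ord1 vv.
Qed.

(** Up to a part where B1 is at most eps times B2, a vector of the B2-ball is
    given by finitely many bounded coordinates, and B1 <= K * B2 controls the
    error made on these. *)
Theorem trace_totally_bounded b eps : 0 < eps ->
  totally_bounded_for [set u | S u /\ B2 u u <= b]
    (fun u v => B1 (u - v) (u - v) <= eps).
Proof.
move=> eps0.
pose b' := `|b| + 1; have b'0 : 0 < b' by rewrite ltr_wpDl.
have [|n [e [oe e_rest]]] := @orthonormal_exhaust (eps / (16 * b')).
  by rewrite divr_gt0// mulr_gt0.
have K0 : 0 <= K.
  by have := @trace_le 0 (fun=> 0); rewrite big_ord0; apply; split=> -[].
(* The mesh eta satisfies K * (n * eta^2) <= eps / 4; with the tail contribution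
   of at most eps / 4, the parallelogram inequality gives eps. *)
pose c := (4 * (K + 1) * (n%:R + 1) / eps).
have n0 : 0 <= n%:R :> R by [].
have c0 : 0 < c by rewrite divr_gt0// !mulr_gt0 ?ltr_wpDl.
pose eta := Num.sqrt c^-1.
have eta0 : 0 < eta by rewrite sqrtr_gt0 invr_gt0.
have eta2 : eta ^+ 2 = c^-1 by rewrite sqr_sqrtr// invr_ge0 ltW.
apply: (totally_bounded_for_le _ _
  (@totally_bounded_for_coord R E n (fun k u => B2 u (e k)) b' _ eta0)).
- move=> u [Su ub] /= k.
  (* 2 |B2 u e| <= B2 u u + B2 e e, as B2 (u + e) and B2 (u - e) are >= 0. *)
  have Sk := oe.1 k; have kk : B2 (e k) (e k) = 1 by rewrite oe.2 eqxx.
  have := semi_inner_ge0 B2P (Slin 1 Su Sk).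
  have := semi_inner_ge0 B2P (Slin (-1) Su Sk).
  rewrite !semi_inner_sqrD// kk ler_norml; have := ler_norm b.
  by rewrite /b'; move: (`|b|) => B *; apply/andP; split; lra.
- move=> u v [Su ub] [Sv vb] /= uv.
  have [Se ee] := oe.
  pose w := u - v; have wE : w = -1 *: v + u by rewrite scaleN1r addrC.
  have Sw : S w by rewrite wE; exact: Slin.
  have w_le : B2 w w <= 4 * b'.
    have Nv : S (- v) by rewrite -(scaleN1r v) -[_ *: v]addr0; exact: Slin.
    have NvE z : S z -> B2 (- v) z = - B2 v z.
      by move=> Sz; rewrite -(scaleN1r v) semi_innerZl// mulN1r.
    have vvE : B2 (- v) (- v) = B2 v v.
      by rewrite NvE// (semi_inner_sym B2P) NvE// opprK.
    have := semi_inner_parallelogram B2P Su Nv; rewrite vvE -/w.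
    have := ler_norm b; rewrite /b'; move: (`|b|) => B *; lra.
  pose t k := B2 w (e k).
  have t_le k : `|t k| <= eta.
    rewrite /t wE (semi_inner_linear B2P)// mulN1r addrC; exact: uv.
  pose p := \sum_k t k *: e k; pose r := w - p.
  have Sp : S p by exact: sub_sum.
  have rE : r = -1 *: p + w by rewrite scaleN1r addrC.
  have Sr : S r by rewrite rE; exact: Slin.
  have pe k : B2 p (e k) = t k by exact: orthonormal_pairing.
  have re k : B2 r (e k) = 0.
    by rewrite rE (semi_inner_linear B2P)// pe mulN1r addNr.
  have pw : B2 p w = \sum_k t k ^+ 2.
    by rewrite semi_inner_suml//; apply: eq_bigr => k _; rewrite (semi_inner_sym B2P).
  have pp : B2 p p = \sum_k t k ^+ 2 by exact: orthonormal_pythagoras.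
  have r_le : B2 r r <= B2 w w.
    rewrite rE semi_inner_sqrD// pp pw; have : 0 <= \sum_k t k ^+ 2.
      by apply: sumr_ge0 => k _; exact: sqr_ge0.
    lra.
  have p_le : B2 p p <= n%:R / c.
    have -> : n%:R / c = \sum_(k < n) eta ^+ 2.
      by rewrite sumr_const card_ord eta2 mulr_natl.
    rewrite pp.
    by apply: ler_sum => k _; rewrite -real_normK ?num_real// lerXn2r ?nnegrE// ltW.
  have -> : u - v = p + r by rewrite /r addrCA subrr addr0.
  apply: (le_trans (semi_inner_parallelogram B1P Sp Sr)).
  have h1 := trace_bound Sp; have h2 := e_rest r Sr re.
  have h3 : K * B2 p p <= eps / 4.
    apply: (le_trans (ler_wpM2l K0 p_le)).
    rewrite /c invfM !invrK.
    rewrite [X in X <= _]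
      (_ : _ = (K * n%:R / ((K + 1) * (n%:R + 1))) * (eps / 4)); last first.
      by field; rewrite !gt_eqF ?ltr_wpDl.
    have eps4 : 0 <= eps / 4 by rewrite divr_ge0// ltW.
    apply: ler_piMl => //; rewrite ler_pdivrMr ?mulr_gt0 ?ltr_wpDl// mul1r.
    by apply: ler_pM => //; rewrite lerDl.
  have h4 : eps / (16 * b') * B2 r r <= eps / 4.
    apply: (le_trans (ler_wpM2l _ (le_trans r_le w_le))).
      by rewrite divr_ge0 ?ltW// mulr_gt0.
    rewrite [X in X <= _](_ : _ = eps / 4)//; field; rewrite gt_eqF//.
  lra.
Qed.
End HilbertSchmidt.

(** * The Dirichlet problem *)

Section Brelot.
Context (R : realType) (X : topologicalType).
Context (H : forall V : set X, set (V -> R)) (tau0 : set (set X)).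
Context (B : brelot H tau0).
Implicit Types (V W K : set X) (f g : X -> R).

(** Functions are defined on the whole of X and only their restrictions matter,
    so that restricting to a smaller set leaves the function unchanged. *)
Definition harmonic_on V f : Prop := H (sigL V f).

Lemma harmonic_on_continuous V f :
  open V -> harmonic_on V f -> {within V, continuous f}.
Proof.
move=> oV Hf; apply/subspace_sigL_continuousP.
exact: (har_continuous B oV Hf).
Qed.

Lemma harmonic_on0 V : open V -> harmonic_on V 0.
Proof. by move=> oV; exact: (har_zero B oV). Qed.

Lemma harmonic_on_linear V a f g : open V ->
  harmonic_on V f -> harmonic_on V g -> harmonic_on V (a *: f + g).
Proof. by move=> oV Hf Hg; exact: (har_linear B a oV Hf Hg). Qed.

Lemma harmonic_onZ V a f : open V -> harmonic_on V f -> harmonic_on V (a *: f).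
Proof.
move=> oV Hf; rewrite -[a *: f]addr0.
by apply: harmonic_on_linear => //; exact: harmonic_on0.
Qed.

Lemma harmonic_on_sub V W f : open V -> open W -> V `<=` W ->
  harmonic_on W f -> harmonic_on V f.
Proof. by move=> oV oW VW Hf; exact: (har_restrict B VW oV oW Hf). Qed.

Lemma valL_val V (k : V -> R) (x : V) : valL_ 0 k (val x) = k x.
Proof. exact: (congr1 (@^~ x) (@valLK _ _ 0 V k)). Qed.

Lemma harmonic_on_sum V n (s : nat -> X -> R) : open V ->
  (forall i, harmonic_on V (s i)) -> harmonic_on V (\sum_(i < n) s i).
Proof.
move=> oV Hs; elim: n => [|n IH]; first by rewrite big_ord0; exact: harmonic_on0.
by rewrite big_ord_recr/= -[X in X + _]scale1r; exact: harmonic_on_linear.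
Qed.

(** In the convergence axiom, a bound at the single point p excludes the
    alternative in which the supremum is identically infinite. *)
Lemma harmonic_majorant V p (s : nat -> X -> R) M : open V -> connected V ->
  V p -> (forall n, harmonic_on V (s n)) ->
  (forall n x, V x -> s n x <= s n.+1 x) -> (forall n, s n p <= M) ->
  exists2 k, harmonic_on V k & forall n x, V x -> s n x <= k x.
Proof.
move=> oV cV Vp Hs s_incr sM.
have [||[k Hk kE]|sup_oo] := har_convergence B (h := fun n => sigL V (s n)) oV cV.
- exact: Hs.
- by move=> n x; apply: s_incr; exact: set_valP.
- exists (valL_ 0 k); first by rewrite /harmonic_on valLK.
  move=> n x Vx; pose y : V := SigSub (mem_set Vx).
  rewrite (_ : x = val y)// valL_val -lee_fin -kE.
  by apply: ereal_sup_ubound; exists n.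
- pose y : V := SigSub (mem_set Vp).
  have : (ereal_sup (range (fun n => (sigL V (s n) y)%:E)) <= M%:E)%E.
    by apply: ge_ereal_sup => _ [n _ <-]; rewrite lee_fin; exact: sM.
  by rewrite sup_oo.
Qed.

Lemma compact_image_ub K f : compact K -> {within K, continuous f} ->
  exists M, forall x, K x -> f x <= M.
Proof.
move=> cK cf; have [K0|K0] := pselect (K !=set0); last first.
  by exists 0 => x Kx; case: K0; exists x.
have [c _ cP] := compact_EVT_max K0 cK cf.
by exists (f c) => x /mem_set; exact: cP.
Qed.

(** Here f carries at once the harmonic function on V, its continuous extension
    to the closure, and its boundary values. *)
Definition dirichlet V g f : Prop :=
  [/\ harmonic_on V f, {within closure V, continuous f} &
      forall y, bdry V y -> f y = g y].

Lemma dirichlet_sigL V g f :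
  dirichlet V g f -> dirichlet_solution H (sigL (bdry V) g) (sigL V f).
Proof.
move=> [Hf cf fg]; split=> //; exists (sigL (closure V) f); split => //.
  exact/subspace_sigL_continuousP.
by move=> y; exact: (fg _ (set_valP y)).
Qed.

Section Solution.
Context (V : set X) (tV : tau0 V).

Lemma dirichlet_ex g : {within bdry V, continuous g} -> exists f, dirichlet V g f.
Proof.
move=> /subspace_sigL_continuousP cg.
have [oV /(_ _ cg)[h [[Hh [F [cF Fh Fg]]] _ _]]] := base_regular B tV.
exists (valL_ 0 F); split.
- rewrite /harmonic_on (_ : sigL V _ = h)//; apply/funext => x.
  exact: etrans (valL_val _ _) (Fh x).
- by apply/subspace_sigL_continuousP; rewrite valLK.
- by move=> y yV; exact: etrans (valL_val _ _) (Fg (SigSub (mem_set yV))).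
Qed.

Lemma dirichlet_uniq g f f' : {within bdry V, continuous g} ->
  dirichlet V g f -> dirichlet V g f' -> forall x, V x -> f x = f' x.
Proof.
move=> /subspace_sigL_continuousP cg /dirichlet_sigL sf /dirichlet_sigL sf' x Vx.
have [oV /(_ _ cg)[h [_ h_uniq _]]] := base_regular B tV.
have := h_uniq _ sf; rewrite -(h_uniq _ sf') => /(congr1 (@^~ (SigSub (mem_set Vx)))).
by [].
Qed.

Lemma dirichlet_ge0 g f : {within bdry V, continuous g} ->
  dirichlet V g f -> (forall y, bdry V y -> 0 <= g y) ->
  forall x, V x -> 0 <= f x.
Proof.
move=> /subspace_sigL_continuousP cg /dirichlet_sigL sf g0 x Vx.
have [oV /(_ _ cg)[h [_ h_uniq h0]]] := base_regular B tV.
have := h0 _ (SigSub (mem_set Vx)); rewrite -(h_uniq _ sf); apply => y.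
by apply: g0; exact: set_valP.
Qed.

(** At a fixed point x of V, the map sending g to [poisson g x] is a positive
    linear functional on boundary functions: integration against the harmonic
    measure of V at x. *)
Definition poisson g : X -> R := xget 0 [set f | dirichlet V g f].

Lemma poissonP g : {within bdry V, continuous g} -> dirichlet V g (poisson g).
Proof. by move=> /dirichlet_ex ex_f; exact: (xgetPex 0 ex_f). Qed.

Lemma poisson_harmonic f x : V x -> harmonic_on V f ->
  {within closure V, continuous f} -> poisson f x = f x.
Proof.
move=> Vx Hf cf.
have cf' : {within bdry V, continuous f}.
  exact: continuous_subspaceW (@bdry_closure _ V) cf.
by apply: (dirichlet_uniq cf') => //; exact: poissonP.
Qed.

Lemma poisson_linear a g g' x : {within bdry V, continuous g} ->
  {within bdry V, continuous g'} -> V x ->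
  poisson (a *: g + g') x = a * poisson g x + poisson g' x.
Proof.
move=> cg cg' Vx.
have cgg : {within bdry V, continuous (a *: g + g')}.
  by move=> z; apply: cvgD; [apply: cvgZr; exact: cg|exact: cg'].
have [oV _] := base_regular B tV.
apply: (dirichlet_uniq (f' := a *: poisson g + poisson g') cgg (poissonP cgg) _ Vx).
have [H1 c1 e1] := poissonP cg; have [H2 c2 e2] := poissonP cg'.
split.
- exact: harmonic_on_linear.
- by move=> z; apply: cvgD; [apply: cvgZr; exact: c1|exact: c2].
- by move=> y yV; rewrite !fctE e1// e2.
Qed.

Lemma poisson_le g g' x : {within bdry V, continuous g} ->
  {within bdry V, continuous g'} -> (forall y, bdry V y -> g y <= g' y) -> V x ->
  poisson g x <= poisson g' x.
Proof.
move=> cg cg' gg' Vx.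
have cgg : {within bdry V, continuous (-1 *: g + g')}.
  by move=> z; apply: cvgD; [apply: cvgZr; exact: cg|exact: cg'].
have : 0 <= poisson (-1 *: g + g') x.
  apply: (dirichlet_ge0 cgg (poissonP cgg) _ Vx) => y yV.
  by rewrite !fctE scaleN1r addrC subr_ge0 gg'.
by rewrite poisson_linear// mulN1r addrC subr_ge0.
Qed.

Lemma poisson0 x : V x -> poisson 0 x = 0.
Proof.
move=> Vx; have c0 : {within bdry V, continuous (0 : X -> R)}.
  by move=> z; exact: (@cvg_cst R).
have := poisson_linear 1 c0 c0 Vx; rewrite mul1r scaler0 addr0.
by move=> /eqP; rewrite -subr_eq0 opprD addNKr oppr_eq0 => /eqP.
Qed.

Lemma poisson_cst a x : V x -> poisson (cst a) x = a * poisson 1 x.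
Proof.
move=> Vx; rewrite -[RHS]addr0 -(poisson0 Vx) -poisson_linear//.
- congr (poisson _ x); apply/funext => z.
  by rewrite !fctE /GRing.scale/= mulr1 addr0.
- by move=> z; exact: (@cvg_cst R).
- by move=> z; exact: (@cvg_cst R).
Qed.
End Solution.
End Brelot.

(** * Harnack's inequality *)

Section Harnack.
Context (R : realType) (X : topologicalType).
Context (H : forall V : set X, set (V -> R)) (tau0 : set (set X)).
Context (B : brelot H tau0).
Implicit Types (V W K : set X) (f g : X -> R).

(** The multiples n f increase and vanish at p, so they are bounded by one
    harmonic function. *)
Lemma harmonic_zero V p f : open V -> connected V -> V p ->
  harmonic_on H V f -> (forall x, V x -> 0 <= f x) -> f p = 0 ->
  forall x, V x -> f x = 0.
Proof.
move=> oV cV Vp Hf f0 fp x Vx.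
have [|||k _ kP] := @harmonic_majorant _ _ _ _ B V p (fun n => n%:R *: f) 0 oV cV Vp.
- by move=> n; exact: (harmonic_onZ B).
- by move=> n y Vy; rewrite !fctE; apply: ler_wpM2r; [exact: f0 | rewrite ler_nat].
- by move=> n; rewrite !fctE fp scaler0.
apply/eqP; rewrite eq_le f0// andbT leNgt; apply/negP => fx0.
have := kP (Num.truncn (k x / f x)).+1 x Vx.
rewrite leNgt => /negP; apply.
by rewrite !fctE -ltr_pdivrMr//; exact: truncnS_gt.
Qed.

(** Otherwise there are nonnegative harmonic f_n and points z_n of K with
    f_n z_n > 4^n f_n p.  With k_n = f_n / (2^n f_n p) the sum of the k_n is 2
    at p, hence harmonic, whereas it exceeds 2^n at z_n: it would be continuous
    and unbounded on K. *)
Lemma harnack_inequality V K p : open V -> connected V -> V p ->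
  compact K -> K `<=` V ->
  exists2 c, 0 <= c & forall f, harmonic_on H V f -> (forall x, V x -> 0 <= f x) ->
    forall x, K x -> f x <= c * f p.
Proof.
move=> oV cV Vp cK KV; apply: contrapT => no_c.
have /choice[fx fxP] : forall n : nat, exists fx : (X -> R) * X,
    [/\ harmonic_on H V fx.1, forall x, V x -> 0 <= fx.1 x, K fx.2 &
        4 ^+ n * fx.1 p < fx.1 fx.2].
  move=> n; apply: contrapT => no_fx; apply: no_c.
  exists (4 ^+ n) => [|f Hf f0 x Kx]; first exact: exprn_ge0.
  by rewrite leNgt; apply/negP => fx; apply: no_fx; exists (f, x).
pose f n := (fx n).1; pose z n := (fx n).2.
have Hf n : harmonic_on H V (f n) by case: (fxP n).
have f0 n x : V x -> 0 <= f n x by case: (fxP n) => _ + _ _; apply.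
have Kz n : K (z n) by case: (fxP n).
have fz n : 4 ^+ n * f n p < f n (z n) by case: (fxP n).
have fp n : 0 < f n p.
  rewrite lt_def f0// andbT; apply/eqP => fp0.
  by have := fz n; rewrite (harmonic_zero oV cV Vp (Hf n) (f0 n) fp0 (KV _ (Kz n)))
                           fp0 mulr0 ltxx.
pose k n := (2 ^+ n * f n p)^-1 *: f n.
have Hk n : harmonic_on H V (k n) by exact: (harmonic_onZ B).
have d0 n : 0 < 2 ^+ n * f n p by rewrite mulr_gt0// exprn_gt0.
have k0 n x : V x -> 0 <= k n x.
  by move=> Vx; rewrite /k !fctE; apply: mulr_ge0; [rewrite invr_ge0 ltW | exact: f0].
have kp n : k n p = 2 ^- n.
  by rewrite /k !fctE /GRing.scale/= invfM -mulrA mulVf ?mulr1// gt_eqF.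
have kz n : 2 ^+ n < k n (z n).
  rewrite /k !fctE /GRing.scale/= mulrC ltr_pdivlMr// mulrA -exprMn.
  by rewrite (_ : 2 * 2 = 4)//; rewrite -natrM.
have sum0 m x : V x -> 0 <= (\sum_(i < m) k i) x.
  move=> Vx; elim: m => [|m IH]; first by rewrite big_ord0.
  by rewrite big_ord_recr/= fctE addr_ge0// k0.
have [|||h Hh hP] := @harmonic_majorant _ _ _ _ B V p
    (fun n => \sum_(i < n) k i) 2 oV cV Vp.
- by move=> n; exact: (harmonic_on_sum B).
- by move=> n x Vx; rewrite big_ord_recr/= fctE lerDl k0.
- move=> n; rewrite (_ : _ p = 2 - 2 * 2 ^- n).
    by rewrite gerBl mulr_ge0// invr_ge0 exprn_ge0.
  elim: n => [|n IH]; first by rewrite big_ord0 expr0 invr1 mulr1 subrr.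
  rewrite big_ord_recr/= fctE IH kp exprS invfM; field.
  by rewrite expf_neq0.
have [M hM] := compact_image_ub cK
  (continuous_subspaceW KV (harmonic_on_continuous B oV Hh)).
have Mlt n : n%:R < M.
  apply: lt_le_trans (hM _ (Kz n)); apply: lt_le_trans (hP n.+1 _ (KV _ (Kz n))).
  rewrite big_ord_recr/= fctE; apply: ltr_wpDl.
    exact/sum0/KV.
  by apply: le_lt_trans (kz n); rewrite -natrX ler_nat ltnW// ltn_expl.
by have := Mlt (Num.truncn M).+1; rewrite ltNge ltW// truncnS_gt.
Qed.

(** A locally compact Hausdorff space is regular, and every point has a
    relatively compact neighbourhood in the base. *)
Lemma shrink_regular p (O : set X) : open O -> O p ->
  exists2 V, tau0 V & V p /\ closure V `<=` O.
Proof.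
move=> oO Op; have [_ bB] := base_basis B.
have [V0 [tV0 V0p] _] := bB p setT filterT.
have cV0 := base_relatively_compact B tV0.
have nV0 : nbhs p (closure V0).
  apply: filterS (@subset_closure _ V0) _; apply: open_nbhs_nbhs; split=> //.
  by case: (base_regular B tV0).
have := compact_regular (brelot_hausdorff B) cV0 nV0 (open_nbhs_nbhs (conj oO Op)).
move=> [N Np NO]; have [V [tV Vp] VN] := bB p N Np.
by exists V => //; split=> //; apply: subset_trans NO; exact: closure_subset.
Qed.

Lemma shrink_connected p (O : set X) : open O -> O p ->
  exists W, [/\ open W, connected W, W p & W `<=` O].
Proof.
by move=> oO Op; exact: (brelot_locally_connected B (open_nbhs_nbhs (conj oO Op))).
Qed.
End Harnack.

(** * Normalized positive harmonic functions *)

Section Montel.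
Context (R : realType) (X : topologicalType).
Context (H : forall V : set X, set (V -> R)) (tau0 : set (set X)).
Context (B : brelot H tau0).
Implicit Types (V W K : set X) (f g : X -> R).

(** The inner product of f and g in L^2 of the harmonic measure of V at p. *)
Definition poisson_form V p f g : R := poisson H V (f * g) p.

Lemma within_continuousM K f g : {within K, continuous f} ->
  {within K, continuous g} -> {within K, continuous (f * g)}.
Proof. by move=> cf cg x; apply: cvgM; [exact: cf | exact: cg]. Qed.

Lemma within_continuous_linear K a f g : {within K, continuous f} ->
  {within K, continuous g} -> {within K, continuous (a *: f + g)}.
Proof. by move=> cf cg x; apply: cvgD; [apply: cvgZr; exact: cf | exact: cg]. Qed.

Lemma within_continuous_cst K (a : R) : {within K, continuous (cst a)}.
Proof. by move=> x; exact: cvg_cst. Qed.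

Lemma poisson_sum V p n (s : 'I_n -> X -> R) : tau0 V -> V p ->
  (forall k, {within bdry V, continuous (s k)}) ->
  {within bdry V, continuous (\sum_k s k)} /\
  poisson H V (\sum_k s k) p = \sum_k poisson H V (s k) p.
Proof.
move=> tV Vp; elim: n s => [|n IH] s cs.
  rewrite !big_ord0 (poisson0 B tV Vp); split=> //.
  exact: (@within_continuous_cst (bdry V) 0).
rewrite !big_ord_recl; have [c1 e1] := IH (fun k => s (lift ord0 k)) (fun k => cs _).
rewrite -[s ord0]scale1r; split; first exact: within_continuous_linear.
by rewrite (poisson_linear B)// e1 mul1r scale1r.
Qed.

Lemma poisson_form_semi_inner V p : tau0 V -> V p ->
  semi_inner [set f | {within bdry V, continuous f}] (poisson_form V p).
Proof.
move=> tV Vp; split=> [a u v w cu cv cw|u v|u cu].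
- rewrite /poisson_form (_ : _ * w = a *: (u * w) + v * w).
    by rewrite (poisson_linear B)//; exact: within_continuousM.
  by apply/funext => x; rewrite !fctE /GRing.scale/= mulrDl mulrA.
- by rewrite /poisson_form mulrC.
- have cuu := within_continuousM cu cu.
  apply: (dirichlet_ge0 B tV cuu (poissonP B tV cuu)) => // y _.
  by rewrite !fctE -expr2 sqr_ge0.
Qed.

(** Cauchy-Schwarz bounds the left-hand side by D_V 1 x * D_V (g^2) x; both
    factors are nonnegative and harmonic in x, so Harnack's inequality moves x to
    p.  The connected W is there because V itself need not be connected. *)
Lemma poisson_sqr_le V W p K : tau0 V -> open W -> connected W -> W p ->
  W `<=` V -> compact K -> K `<=` W ->
  exists2 c, 0 <= c & forall g, {within bdry V, continuous g} ->
    forall x, K x -> poisson H V g x ^+ 2 <= c * poisson_form V p g g.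
Proof.
move=> tV oW cW Wp WV cK KW.
have oV : open V by case: (base_regular B tV).
have [c c0 harnack] := harnack_inequality B oW cW Wp cK KW.
have c1 : {within bdry V, continuous (1 : X -> R)} by exact: (@within_continuous_cst _ 1).
have form1 g x : poisson_form V x g 1 = poisson H V g x.
  by rewrite /poisson_form mulr1.
have P_ge0 x : V x -> 0 <= poisson_form V x 1 1.
  by move=> Vx; exact: (semi_inner_ge0 (poisson_form_semi_inner tV Vx)).
have P_le g x : {within bdry V, continuous g} -> K x ->
    poisson_form V x g g <= c * poisson_form V p g g.
  move=> cg Kx; have cgg := within_continuousM cg cg.
  apply: harnack => //.
    by apply: (harmonic_on_sub B oW oV WV); case: (poissonP B tV cgg).
  by move=> y Wy; exact: (semi_inner_ge0 (poisson_form_semi_inner tV (WV _ Wy))).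
exists (c * poisson_form V p 1 1 * c); first by rewrite !mulr_ge0// P_ge0//; exact: WV.
move=> g cg x Kx; have Vx := WV _ (KW _ Kx).
rewrite -form1.
have S0 : [set f : X -> R | {within bdry V, continuous f}] 0.
  exact: (@within_continuous_cst _ 0).
apply: (le_trans (semi_inner_Cauchy_Schwarz _ (poisson_form_semi_inner tV Vx) cg c1)).
  by move=> a u v; exact: within_continuous_linear.
rewrite mulrC -mulrA; apply: ler_pM => //; last exact: P_le.
- exact: P_ge0.
- exact: (semi_inner_ge0 (poisson_form_semi_inner tV Vx)).
- exact: P_le.
Qed.

Definition normalized_harmonic U x0 : set (X -> R) :=
  [set f | [/\ harmonic_on H U f, forall x, U x -> 0 <= f x & f x0 = 1]].

Lemma semi_inner_sub (S S' : set (X -> R)) form : S `<=` S' ->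
  semi_inner S' form -> semi_inner S form.
Proof.
move=> SS' [l s p]; split=> // [a u v w Su Sv Sw|u Su].
- by apply: l; exact: SS'.
- by apply: p; exact: SS'.
Qed.

(** The Hilbert-Schmidt argument: evaluations on the closure of V1 are bounded
    for the form B2 of V2, which bounds the trace of the form B1 of V1 relative
    to B2; evaluations on V0 are bounded for B1, which turns total boundedness
    for B1 into uniform total boundedness on V0. *)
Lemma locally_totally_bounded U x0 p : open U -> connected U -> U x0 -> U p ->
  exists2 O, open O /\ O p & forall eps, 0 < eps ->
    totally_bounded_for (normalized_harmonic U x0)
      (fun f g => forall x, O x -> `|f x - g x| <= eps).
Proof.
move=> oU cU Ux0 Up.
have [V2 tV2 [V2p V2U]] := shrink_regular B oU Up.
have oV2 : open V2 by case: (base_regular B tV2).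
have [W2 [oW2 cW2 W2p W2V2]] := shrink_connected B oV2 V2p.
have [V1 tV1 [V1p V1W2]] := shrink_regular B oW2 W2p.
have oV1 : open V1 by case: (base_regular B tV1).
have [W1 [oW1 cW1 W1p W1V1]] := shrink_connected B oV1 V1p.
have [V0 tV0 [V0p V0W1]] := shrink_regular B oW1 W1p.
have oV0 : open V0 by case: (base_regular B tV0).
have V1V2 : closure V1 `<=` V2 by exact: subset_trans V1W2 W2V2.
have V1U : closure V1 `<=` U.
  exact: subset_trans V1V2 (subset_trans (@subset_closure _ _) V2U).
have [c2 c20 sqr_le2] :=
  poisson_sqr_le tV2 oW2 cW2 W2p W2V2 (base_relatively_compact B tV1) V1W2.
have [c1 c10 sqr_le1] :=
  poisson_sqr_le tV1 oW1 cW1 W1p W1V1 (base_relatively_compact B tV0) V0W1.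
have [c c_ge0 harnack] :=
  harnack_inequality B oU cU Ux0 (base_relatively_compact B tV2) V2U.
pose S : set (X -> R) := harmonic_on H U.
have Slin a u v : S u -> S v -> S (a *: u + v) by exact: (harmonic_on_linear B).
have S0 : S 0 by exact: (harmonic_on0 B).
have Scont K : K `<=` U -> S `<=` [set f | {within K, continuous f}].
  by move=> KU f Sf; exact: continuous_subspaceW KU (harmonic_on_continuous B oU Sf).
have bV2U : bdry V2 `<=` U by exact: subset_trans (@bdry_closure _ _) V2U.
have bV1U : bdry V1 `<=` U by exact: subset_trans (@bdry_closure _ _) V1U.
pose B2 := poisson_form V2 p; pose B1 := poisson_form V1 p.
have B2P : semi_inner S B2.
  exact: semi_inner_sub (Scont _ bV2U) (poisson_form_semi_inner tV2 V2p).
have B1P : semi_inner S B1.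
  exact: semi_inner_sub (Scont _ bV1U) (poisson_form_semi_inner tV1 V1p).
have poissonE V x f : tau0 V -> closure V `<=` U -> V x -> S f -> poisson H V f x = f x.
  move=> tV VU Vx Sf; have oV : open V by case: (base_regular B tV).
  apply: (poisson_harmonic B tV Vx); last exact: Scont.
  by apply: (harmonic_on_sub B oV oU) => // y Vy; exact/VU/subset_closure.
have S_le2 f x : S f -> closure V1 x -> f x ^+ 2 <= c2 * B2 f f.
  move=> Sf Vx; rewrite -(poissonE V2)//; last exact: V1V2.
  by apply: sqr_le2 => //; exact: Scont.
have S_le1 f x : S f -> V0 x -> f x ^+ 2 <= c1 * B1 f f.
  move=> Sf Vx; have V0x := subset_closure Vx.
  rewrite -(poissonE V1)//; last exact/W1V1/V0W1.
  by apply: sqr_le1 => //; exact: Scont.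
have ccst V a : {within bdry V, continuous (cst a : X -> R)}.
  exact: within_continuous_cst.
pose K := c2 * poisson H V1 1 p.
have trace n (e : 'I_n -> X -> R) : orthonormal S B2 e -> \sum_k B1 (e k) (e k) <= K.
  move=> oe; have [Se _] := oe.
  have [cs <-] := @poisson_sum V1 p n (fun k => e k * e k) tV1 V1p
    (fun k => within_continuousM (Scont _ bV1U _ (Se k)) (Scont _ bV1U _ (Se k))).
  rewrite /K -(poisson_cst B tV1 c2 V1p); apply: (poisson_le B tV1) => // y yV.
  set s := (\sum_k _) y.
  have sE : s = \sum_k e k y ^+ 2.
    by rewrite /s fct_sumE; apply: eq_bigr => k _; rewrite fctE expr2.
  (* u represents the evaluation at y in the span of the e k, so its value at y
     is also its B2-square; hence s^2 <= c2 * s. *)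
  pose u := \sum_k e k y *: e k.
  have uy : u y = s.
    by rewrite /u fct_sumE sE; apply: eq_bigr => k _; rewrite expr2.
  have := S_le2 u y (sub_sum S0 Slin _ Se) (@bdry_closure _ _ _ yV).
  rewrite (orthonormal_pythagoras S0 Slin B2P)// -sE uy.
  have [->//|s0] := eqVneq s 0.
  have s_ge0 : 0 <= s by rewrite sE; apply: sumr_ge0 => k _; exact: sqr_ge0.
  by rewrite expr2 ler_pM2r// lt_def s0.
have null u : S u -> B2 u u = 0 -> B1 u u = 0.
  move=> Su uu0; apply/eqP; rewrite eq_le (semi_inner_ge0 B1P)// andbT.
  rewrite -(mul0r (poisson H V1 1 p)) -(poisson_cst B tV1 0 V1p).
  have cu := Scont _ bV1U _ Su.
  apply: (poisson_le B tV1) => //; first exact: within_continuousM.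
  by move=> y /bdry_closure yV; have := S_le2 u y Su yV; rewrite uu0 mulr0.
have TB := trace_totally_bounded S0 Slin B1P B2P trace null.
exists V0 => // eps eps0.
have e0 : 0 < eps ^+ 2 / (c1 + 1) by rewrite divr_gt0// ?exprn_gt0// ltr_wpDl.
apply: (totally_bounded_for_le _ _ (TB (c ^+ 2 * poisson H V2 1 p) _ e0)).
- move=> f [Sf f_ge0 f1]; split=> //.
  rewrite -(poisson_cst B tV2 (c ^+ 2) V2p); have cf := Scont _ bV2U _ Sf.
  apply: (poisson_le B tV2) => //; first exact: within_continuousM.
  move=> y yV; have Uy := bV2U _ yV; have := f_ge0 _ Uy.
  have := harnack f Sf f_ge0 y (bdry_closure yV); rewrite f1 mulr1.
  by move=> fc fy; rewrite /cst expr2; exact: ler_pM.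
- move=> f g [Sf _ _] [Sg _ _] fg x Vx.
  have Sfg : S (f - g) by rewrite addrC -scaleN1r; exact: Slin.
  have := S_le1 _ _ Sfg Vx.
  move=> /le_trans/(_ (ler_wpM2l c10 fg)) sqr_le.
  rewrite -(ler_pXn2r (n := 2))// ?nnegrE ?(ltW eps0)// real_normK ?num_real//.
  apply: le_trans sqr_le _.
  rewrite mulrCA ler_piMr ?exprn_ge0 ?(ltW eps0)//.
  by rewrite ler_pdivrMr ?mul1r ?lerDl// ltr_wpDl.
Qed.

(** The sets on which the conclusion holds are stable under finite unions, so
    the local statement extends to compact sets. *)
Lemma totally_bounded_on_compact U x0 K eps : open U -> connected U -> U x0 ->
  compact K -> K `<=` U -> 0 < eps ->
  totally_bounded_for (normalized_harmonic U x0)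
    (fun f g => forall x, K x -> `|f x - g x| <= eps).
Proof.
move=> oU cU Ux0 cK KU eps0.
pose close A f g := forall x : X, A x -> `|f x - g x| <= eps.
pose TB A := totally_bounded_for (normalized_harmonic U x0) (close A).
have TB0 : TB set0 by exists unit, (fun=> tt) => f g _ _ _ x [].
have TBU A A' : TB A -> TB A' -> TB (A `|` A').
  move=> tA tA'; apply: totally_bounded_for_le (totally_bounded_forI tA tA') => //.
  by move=> f g _ _ [fgA fgA'] x [Ax|A'x]; [exact: fgA | exact: fgA'].
pose F := filter_from TB (fun A => [set A' | A `<=` A']).
have FF : Filter F.
  apply: filter_from_filter; first by exists set0.
  move=> A A' tA tA'; exists (A `|` A'); first exact: TBU.
  by move=> A'' AA'; split=> x Ax; apply: AA'; [left | right].
have [|A tA KA] := (compact_near_coveringP K).1 cK (set X) F (fun A x => A x) FF.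
  move=> x Kx.
  have [N [oN Nx] /(_ _ eps0) tN] :=
    locally_totally_bounded oU cU Ux0 (KU _ Kx).
  exists (N, [set A | N `<=` A]) => /=; last by move=> [y A] /= [Ny]; exact.
  by split; [exact: open_nbhs_nbhs | exists N].
apply: totally_bounded_for_le tA => // f g _ _ fg x.
by move=> /(KA A (@subset_refl _ A)); exact: fg.
Qed.
End Montel.

(** * Separated tuples and the order property *)

Section Connectives.
Context (R : realType) (L : signature).
Implicit Types (M N : structure R L) (G : seq (Defs.sort L)).

Lemma formula_unary_continuous (u : R -> R) : continuous u ->
  continuous (fun v : 'rV[R]_1 => u (v 0 0)).
Proof.
by move=> cu v; apply: continuous_comp; [exact: coord_continuous | exact: cu].
Qed.

Definition formula_unary G (u : R -> R) (cu : continuous u) (phi : formula R G) :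
    formula R G :=
  FConn (formula_unary_continuous cu) (fun=> phi).

Lemma formula_binary_continuous (u : R * R -> R) : continuous u ->
  continuous (fun v : 'rV[R]_2 => u (v 0 0, v 0 1)).
Proof.
move=> cu v.
apply: (@continuous_comp _ _ _ (fun v : 'rV[R]_2 => (v 0 0, v 0 1)) u); last exact: cu.
have c i : (fun v : 'rV[R]_2 => v 0 i) @ v --> v 0 i by exact: coord_continuous.
exact: (cvg_pair (c 0) (c 1)).
Qed.

Definition formula_binary G (u : R * R -> R) (cu : continuous u)
    (phi psi : formula R G) : formula R G :=
  FConn (formula_binary_continuous cu)
    (fun i : 'I_2 => if i == 0 then phi else psi).

Lemma eval_binary M G u (cu : continuous u) (phi psi : formula R G) (e : env M G) :
  eval_formula (formula_binary cu phi psi) e =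
  u (eval_formula phi e, eval_formula psi e).
Proof. by rewrite /= !mxE. Qed.

Definition formula_cst G (a : R) : formula R G :=
  FConn (@cst_continuous 'rV[R]_0 R a)
    (fun i : 'I_0 => False_rect _ (notF (ltn_ord i))).

Lemma minr_continuous : continuous (fun z : R * R => Num.min z.1 z.2).
Proof. by move=> z; apply: continuous_min; [exact: cvg_fst | exact: cvg_snd]. Qed.

Lemma distr_continuous : continuous (fun z : R * R => `|z.1 - z.2|).
Proof.
by move=> z; apply: cvg_norm; apply: cvgB; [exact: cvg_fst | exact: cvg_snd].
Qed.

Lemma excess_continuous (t : R) : continuous (fun y : R => Num.max (y - t) 0).
Proof.
move=> y; apply: (@continuous_max _ R (fun y => y - t) (cst 0)); last exact: cvg_cst.
by apply: cvgB; [exact: cvg_id | exact: cvg_cst].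
Qed.

Fixpoint sup_closure s k : formula R (nseq k s) -> sentence R L :=
  if k is k'.+1 return formula R (nseq k s) -> sentence R L
  then fun phi => sup_closure (@FSup R L (nseq k' s) 0 1 s phi) else id.

(** Truncation to [0, 1] does not affect comparisons with a t in [0, 1), and
    0 <= t covers the empty sorts, where suprema are 0. *)
Lemma clamp_le (t y : R) : 0 <= t -> y <= t -> clamp 0 1 y <= t.
Proof. by move=> t0 yt; rewrite /clamp ge_max t0 ge_min yt orbT. Qed.

Lemma sup_clamp_ub (T : Type) (f : T -> R) x :
  clamp 0 1 (f x) <= sup (range (fun x => clamp 0 1 (f x))).
Proof.
apply: ub_le_sup; last by exists x.
by exists 1 => _ [y _ <-]; rewrite /clamp ge_max ler01 ge_min lexx.
Qed.

Lemma sup_clamp_le (T : Type) (f : T -> R) t : 0 <= t ->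
  (forall x, f x <= t) -> sup (range (fun x => clamp 0 1 (f x))) <= t.
Proof.
move=> t0 ft; have [[x _]|T0] := pselect (exists x : T, True).
  apply: ge_sup; first by exists (clamp 0 1 (f x)), x.
  by move=> _ [y _ <-]; exact: clamp_le.
suff -> : range (fun x => clamp 0 1 (f x)) = set0 by rewrite sup0.
by apply/seteqP; split=> // _ [y _ <-]; case: T0; exists y.
Qed.

Lemma clamp_le_lt1 (t y : R) : t < 1 -> clamp 0 1 y <= t -> y <= t.
Proof.
by move=> t1; rewrite /clamp ge_max ge_min [1 <= t]leNgt t1 => /andP[_].
Qed.

Lemma sup_closure_le M s k (phi : formula R (nseq k s)) t : 0 <= t ->
  (forall e : env M (nseq k s), eval_formula phi e <= t) ->
  @eval_formula R L M [::] (sup_closure phi) tt <= t.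
Proof.
move=> t0; elim: k phi => [|k IH] phi phi_le /=; first exact: phi_le.
by apply: IH => e; apply: sup_clamp_le => // x; exact: phi_le.
Qed.

Lemma le_sup_closure M s k (phi : formula R (nseq k s)) t : t < 1 ->
  @eval_formula R L M [::] (sup_closure phi) tt <= t ->
  forall e : env M (nseq k s), eval_formula phi e <= t.
Proof.
move=> t1; elim: k phi => [|k IH] phi /=; first by move=> ? [].
move=> /IH sup_le [x e]; apply: (clamp_le_lt1 t1).
by apply: le_trans (sup_le e); exact: (sup_clamp_ub (fun x => eval_formula phi (x, e))).
Qed.

Fixpoint block_vars (s : Defs.sort L) k : seq (var (nseq k s) s) :=
  if k is k'.+1 return seq (var (nseq k s) s)
  then VZ s (nseq k' s) :: map (@VS _ s s (nseq k' s)) (block_vars s k') else [::].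

Definition env_seq M s k (e : env M (nseq k s)) : seq (M s) :=
  [seq lookup v e | v <- block_vars s k].

Lemma env_seqS M s k (x : M s) (e : env M (nseq k s)) :
  env_seq (k := k.+1) (x, e) = x :: env_seq e.
Proof. by rewrite /env_seq/= -map_comp. Qed.

Fixpoint env_of M s (f : nat -> M s) k : env M (nseq k s) :=
  if k is k'.+1 return env M (nseq k s)
  then (f 0%N, env_of (fun i => f i.+1) k') else tt.

Lemma env_seq_of M s (f : nat -> M s) k : env_seq (env_of f k) = mkseq f k.
Proof.
elim: k f => [//|k IH] f; rewrite [env_of _ _]/= env_seqS IH.
by rewrite /mkseq/= -[1%N]/(1 + 0)%N iotaDl -map_comp.
Qed.

Lemma size_env_seq M s k (e : env M (nseq k s)) : size (env_seq e) = k.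
Proof. by elim: k e => [//|k IH] [x e]; rewrite env_seqS/= IH. Qed.

(** A predicate with one variable of sort s and one of sort t is given as a
    family delta of formulas, so that its variables may be placed in any
    context. *)
Section Separation.
Context (s t : Defs.sort L) (delta : forall G, var G s -> var G t -> formula R G).
Context (value : forall M, M s -> M t -> R).
Context (deltaE : forall M G (v : var G s) (w : var G t) (e : env M G),
  eval_formula (delta v w) e = value (lookup v e) (lookup w e)).

Definition instance_dist M (x y : M s) : R :=
  sup (range (fun z : M t => clamp 0 1 `|value x z - value y z|)).

Definition instance_dist_formula G (v w : var G s) : formula R G :=
  @FSup R L G 0 1 t (formula_binary distr_continuous
    (delta (VS t v) (VZ t G)) (delta (VS t w) (VZ t G))).

Lemma eval_instance_dist M G (v w : var G s) (e : env M G) :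
  eval_formula (instance_dist_formula v w) e =
  instance_dist (lookup v e) (lookup w e).
Proof.
rewrite [LHS]/=; apply: (congr1 (fun h : M t -> R => sup (range h))).
apply/funext => z.
by rewrite !mxE/= !deltaE.
Qed.

(** The value 1 on lists with no pair is neutral for the minimum, distances
    being truncated to [0, 1]. *)
Fixpoint separation_formula G (vs : seq (var G s)) : formula R G :=
  if vs is v :: vs' then
    foldr (fun w => formula_binary minr_continuous (instance_dist_formula v w))
      (separation_formula vs') vs'
  else formula_cst G 1.

Lemma eval_separation M G (vs : seq (var G s)) (e : env M G) r : r < 1 ->
  (r < eval_formula (separation_formula vs) e) =
  pairwise (fun x y => r < instance_dist x y) [seq lookup v e | v <- vs].
Proof.
move=> r1; elim: vs => [|v vs IH]; first by rewrite [eval_formula _ _]/= r1.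
rewrite [separation_formula _]/= [RHS]/= -IH; move: (separation_formula vs) => phi.
elim: vs {IH} => [|w ws IHw] //.
rewrite [foldr _ _ _]/= eval_binary lt_min eval_instance_dist IHw.
by rewrite [in RHS]/= andbA.
Qed.

Lemma instance_dist_le M (x y : M s) r : 0 <= r ->
  (forall z, `|value x z - value y z| <= r) -> instance_dist x y <= r.
Proof. by move=> r0 xy; rewrite /instance_dist; exact: sup_clamp_le. Qed.

(** A theory consists of the sentences of value 0, so the bound by r is
    expressed by the excess over r. *)
Definition separation_sentence k r : sentence R L :=
  formula_unary (@excess_continuous r)
    (sup_closure (separation_formula (block_vars s k))).

(** In N the tuple is given as the first k values of a sequence, which is how
    it arises from the order property. *)
Lemma no_separated_tuple_elementary M N k r : 0 <= r -> r < 1 ->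
  models N (theory M) ->
  (forall xs : seq (M s), size xs = k ->
     ~~ pairwise (fun x y => r < instance_dist x y) xs) ->
  forall f : nat -> N s, ~~ pairwise (fun x y => r < instance_dist x y) (mkseq f k).
Proof.
move=> r0 r1 NM noM f.
have : theory M (separation_sentence k r).
  rewrite /theory/= mxE; apply/max_idPr; rewrite subr_le0.
  apply: sup_closure_le => // e; rewrite leNgt eval_separation//.
  by apply: noM; rewrite size_env_seq.
move=> /NM; rewrite /theory/= mxE => /max_idPr; rewrite subr_le0.
move=> /(le_sup_closure r1)/(_ (env_of f k)); rewrite leNgt eval_separation//.
by rewrite -/(env_seq _) env_seq_of.
Qed.

(** Only the a_i of even index are used, so that for i < j the index of b_(2i+1)
    is strictly between those of a_(2i) and a_(2j), which it tells apart by eps. *)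
Lemma stable_of_no_separated_tuple M :
  (forall r, 0 < r -> exists k, forall xs : seq (M s), size xs = k ->
     ~~ pairwise (fun x y => r < instance_dist x y) xs) ->
  forall N, models N (theory M) ->
  ~ exists (eps r : R) (a : nat -> N s) (b : nat -> N t),
      0 < eps /\ forall i j, (i < j)%N ->
        value (a i) (b j) <= r /\ r + eps <= value (a j) (b i).
Proof.
move=> noM N NM [eps [r [a [b [eps0 ab]]]]].
pose q := Num.min 1 eps / 2.
have m0 : 0 < Num.min 1 eps by rewrite lt_min ltr01.
have q0 : 0 < q by rewrite divr_gt0.
have q_lt : q < Num.min 1 eps by rewrite /q; lra.
have q1 : q < 1 by apply: (lt_le_trans q_lt); rewrite ge_min lexx.
have [k noMk] := noM q q0.
have /negP := no_separated_tuple_elementary (ltW q0) q1 NM noMk (fun i => a i.*2).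
apply; rewrite /mkseq pairwise_map.
apply: (@sub_pairwise _ ltn); last first.
  by rewrite -(sorted_pairwise ltn_trans) iota_ltn_sorted.
move=> i j /= ij; pose z := b i.*2.+1.
have := sup_clamp_ub (fun z => `|value (a i.*2) z - value (a j.*2) z|) z.
apply: lt_le_trans; apply: (lt_le_trans q_lt).
have [ai _] := ab i.*2 i.*2.+1 (ltnSn _).
have [_ aj] := ab i.*2.+1 j.*2 ltac:(by rewrite -doubleS leq_double).
rewrite /clamp le_max le_min !ge_min lexx /=; apply/orP; right; apply/orP; right.
by rewrite distrC; apply: le_trans (ler_norm _); rewrite /z; lra.
Qed.
End Separation.
End Connectives.

(** * Stability of the evaluation predicates *)

Theorem theorem5p3 (R : realType) (X : topologicalType)
  (H : forall V : set X, set (V -> R)) (tau0 : set (set X))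
  (B : brelot H tau0)
  (U : tau0) (x0 : val U) (A : set (val U))
  (C : nat -> set (val U)) (c : nat -> R)
  (HL : local_setting H x0 A C c)
  (E : Type) (arity : E -> seq (har_sort tau0))
  (ext : forall e : E, env (har_carrier H x0 C) (arity e) -> R)
  (d : forall s, har_carrier H x0 C s -> har_carrier H x0 C s -> R)
  (dP : forall s, is_metric (@d s))
  (theta_uc : forall n, theta_uniformly_continuous c d n) :
  forall n : nat,
    stable (theory (local_structure A c B ext dP))
           (theta_formula R x0 A arity n).
Proof.
move=> n N NM.
pose delta (G : seq (Defs.sort (LHar x0 A arity))) (v : var G (SPos tau0))
    (w : var G (SExh tau0 n)) : formula R G :=
  @FPred R (LHar x0 A arity) G (PTheta tau0 E n) (TCons (Var v) (TCons (Var w) (TNil G))).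
pose value (M : structure R (LHar x0 A arity)) (x : M (SPos tau0))
    (z : M (SExh tau0 n)) : R := @pint R _ M (PTheta tau0 E n) (x, (z, tt)).
have deltaE (M : structure R (LHar x0 A arity)) (G : seq (Defs.sort (LHar x0 A arity)))
    (v : var G (SPos tau0)) (w : var G (SExh tau0 n)) (e : env M G) :
    eval_formula (delta G v w) e = value M (lookup v e) (lookup w e) by [].
have [oU _] := base_regular B (set_valP U).
pose K := val @` C n.
have cK : compact K.
  have cC : compact (C n) by exact: (exh_compact HL).
  apply: (continuous_compact (f := @set_val X (val U)) _ cC).
  by apply: continuous_subspaceT; exact: initial_continuous.
have KU : K `<=` val U by move=> _ [z _ <-]; exact: set_valP.
have no_tuple r : 0 < r -> exists k, forall xs : seq (har_carrier H x0 C (SPos tau0)),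
    size xs = k -> ~~ pairwise (fun x y => r < instance_dist value
      (M := local_structure A c B ext dP) x y) xs.
  move=> r0.
  have [T [color colorP]] := totally_bounded_on_compact B oU (local_connected HL)
    (set_valP x0) cK KU r0.
  pose extend (h : har_carrier H x0 C (SPos tau0)) : X -> R := valL_ 0 (sval h).
  have extendP h : normalized_harmonic H (val U) (val x0) (extend h).
    have [Hh h0 h1] := svalP h; split.
    - by rewrite /harmonic_on valLK.
    - move=> x Ux; rewrite (_ : x = val (SigSub (mem_set Ux) : val U))//.
      by rewrite /extend valL_val; exact: h0.
    - by rewrite /extend valL_val.
  (* A tuple with one more member than there are colours repeats a colour. *)
  exists #|T|.+1 => xs sz; apply/negP => sep.
  have : uniq (map (color \o extend) xs).
    rewrite uniq_pairwise pairwise_map; apply: sub_pairwise sep => h h' /=.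
    rewrite ltNge; apply: contra => /eqP hh'.
    apply: instance_dist_le; first exact: ltW.
    move=> z; rewrite /value/= /theta -mulrBl.
    have c1 := harnack_ge1 HL n; have c0 : 0 < c n by exact: lt_le_trans c1.
    rewrite normrM (gtr0_norm (x := _^-1)) ?invr_gt0// ler_pdivrMr//.
    have zK : K (val (val z)) by exists (val z) => //; exact: set_valP.
    have := colorP _ _ (extendP h) (extendP h') hh' _ zK.
    rewrite /extend !valL_val => /le_trans; apply.
    by rewrite ler_peMr// ltW.
  move=> /card_uniqP; rewrite size_map sz => card_colors.
  by have := max_card (mem (map (color \o extend) xs)); rewrite card_colors ltnn.
case=> eps [r [a [b [eps0 ab]]]].
apply: (stable_of_no_separated_tuple deltaE
  (M := local_structure A c B ext dP) no_tuple NM).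
by exists eps, r, (fun i => (a i).1), (fun i => (b i).1).
Qed.
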